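(* Let $\mathcal{X}\subset\mathbb{R}^n$, $\mathcal{Y}\subset\mathbb{R}^m$ be nonempty convex compact sets, neither equal to $\{\boldsymbol{0}\}$, and let $F:\mathcal{X}\times\mathcal{Y}\to\mathbb{R}$ be a subdifferentiable convex-concave function (convex in $\boldsymbol{x}$, concave in $\boldsymbol{y}$). Suppose $\|\boldsymbol{f}\|_2\le L_x$ and $\|\boldsymbol{g}\|_2\le L_y$ for all $(\boldsymbol{x},\boldsymbol{y})\in\mathcal{X}\times\mathcal{Y}$, $\boldsymbol{f}\in\partial_{\boldsymbol{x}}F(\boldsymbol{x},\boldsymbol{y})$, $\boldsymbol{g}\in\partial_{\boldsymbol{y}}F(\boldsymbol{x},\boldsymbol{y})$. Let $L=\max\{L_x,L_y\}$ and $\kappa=\max\{\max\{\|\boldsymbol{x}\|_2,\|\boldsymbol{y}\|_2\}:\boldsymbol{x}\in\mathcal{X},\boldsymbol{y}\in\mathcal{Y}\}$. 1. Let $p\in\mathbb{N}$ and $\omega_t=t^p$ for all $t\ge1$. Let $(\boldsymbol{x}_t)_{t\ge1},(\boldsymbol{y}_t)_{t\ge1}$ be generated by the repeated game framework in which both players use CBA with payoff weights $(\omega_t)_{t\ge1}$, let $S_T=\sum_{t=1}^T\omega_t$ and $(\bar{\boldsymbol{x}}_T,\bar{\boldsymbol{y}}_T)=\sum_{t=1}^T\omega_t(\boldsymbol{x}_t,\boldsymbol{y}_t)/S_T$. Then $$\max_{\boldsymbol{y}\in\mathcal{Y}}F(\bar{\boldsymbol{x}}_T,\boldsymbol{y})-\min_{\boldsymbol{x}\in\mathcal{X}}F(\boldsymbol{x},\bar{\boldsymbol{y}}_T)=O\left(\frac{\kappa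 L\sqrt{p+1}}{\sqrt T}\right).$$ 2. Let $p,q\in\mathbb{N}$ with $q\ge p$, and let $\theta_t=t^q$, $\omega_t=t^p$ for all $t\ge1$. Let $(\boldsymbol{x}_t)_{t\ge1},(\boldsymbol{y}_t)_{t\ge1}$ be generated by the repeated game framework in which both players use CBA$^+$ with aggregate payoff weights $(\omega_t)_{t\ge1}$, let $S_T=\sum_{t=1}^T\theta_t$ and $(\bar{\boldsymbol{x}}_T,\bar{\boldsymbol{y}}_T)=\sum_{t=1}^T\theta_t(\boldsymbol{x}_t,\boldsymbol{y}_t)/S_T$. Then $$\max_{\boldsymbol{y}\in\mathcal{Y}}F(\bar{\boldsymbol{x}}_T,\boldsymbol{y})-\min_{\boldsymbol{x}\in\mathcal{X}}F(\boldsymbol{x},\bar{\boldsymbol{y}}_T)=O\left(\frac{\kappa L(q+1)}{\sqrt{p+1}\sqrt T}\right).$$ Here $O(\cdot)$ hides an absolute constant (independent of $T,p,q,\kappa,L,n,m$ and the problem data).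
   Context: $\partial_{\boldsymbol{x}}F$ denotes the set of subgradients of $F$ in $\boldsymbol{x}$ and $\partial_{\boldsymbol{y}}F$ the set of supergradients of the concave function $F(\boldsymbol{x},\cdot)$; subdifferentiable means these are nonempty at every point of $\mathcal{X}\times\mathcal{Y}$. $\mathbb{N}$ contains $0$. Regret minimizers. For a nonempty convex compact set $\mathcal{Z}\subset\mathbb{R}^k$ let $\kappa_{\mathcal{Z}}=\max_{\boldsymbol{z}\in\mathcal{Z}}\|\boldsymbol{z}\|_2>0$, $\mathcal{C}=\{\alpha(\kappa_{\mathcal{Z}},\boldsymbol{z}):\alpha\ge0,\boldsymbol{z}\in\mathcal{Z}\}\subset\mathbb{R}^{k+1}$, and $\pi_{\mathcal{C}}$ the Euclidean projection onto $\mathcal{C}$. For $\boldsymbol{w}=(\tilde w,\hat{\boldsymbol{w}})\in\mathcal{C}$ let $D(\boldsymbol{w})=(\kappa_{\mathcal{Z}}/\tilde w)\hat{\boldsymbol{w}}$ if $\tilde w\neq0$ and $D(\boldsymbol{w})=\boldsymbol{z}_0$, a fixed arbitrary point of $\mathcal{Z}$, if $\tilde w=0$. Given losses $\boldsymbol{h}_1,\boldsymbol{h}_2,\ldots\in\mathbb{R}^k$ and decisions $\boldsymbol{z}_1,\boldsymbol{z}_2,\dots$, write $\boldsymbol{v}_t=(\langle\boldsymbol{h}_t,\boldsymbol{z}_t\rangle/\kappa_{\mathcal{Z}},-\boldsymbol{h}_t)$. - CBA with payoff weights $(\omega_t)$: $\boldsymbol{z}_1\in\mathcal{Z}$ arbitrary,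 $\boldsymbol{u}_1=\omega_1\boldsymbol{v}_1$; for $t\ge1$, $\boldsymbol{z}_{t+1}=D(\pi_{\mathcal{C}}(\boldsymbol{u}_t))$ and $\boldsymbol{u}_{t+1}=\boldsymbol{u}_t+\omega_{t+1}\boldsymbol{v}_{t+1}$. - CBA$^+$ with payoff weights $(\omega_t)$: $\boldsymbol{z}_1\in\mathcal{Z}$ arbitrary, $\boldsymbol{u}_1=\pi_{\mathcal{C}}(\omega_1\boldsymbol{v}_1)$; for $t\ge1$, $\boldsymbol{z}_{t+1}=D(\boldsymbol{u}_t)$ and $\boldsymbol{u}_{t+1}=\pi_{\mathcal{C}}(\boldsymbol{u}_t+\omega_{t+1}\boldsymbol{v}_{t+1})$. Repeated game framework. At each iteration $t\ge1$ the players choose $\boldsymbol{x}_t\in\mathcal{X}$ and $\boldsymbol{y}_t\in\mathcal{Y}$ simultaneously using their regret minimizers; the first player (on $\mathcal{Z}=\mathcal{X}$) then observes the loss $\boldsymbol{h}_t=\boldsymbol{f}_t\in\partial_{\boldsymbol{x}}F(\boldsymbol{x}_t,\boldsymbol{y}_t)$, and the second player (on $\mathcal{Z}=\mathcal{Y}$), who maximizes, observes $\boldsymbol{g}_t\in\partial_{\boldsymbol{y}}F(\boldsymbol{x}_t,\boldsymbol{y}_t)$ and uses the loss $\boldsymbol{h}_t=-\boldsymbol{g}_t$. *)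

(* Defs.v *)
From HB Require Import structures.
From mathcomp Require Import all_boot all_order all_algebra.
From mathcomp Require Import all_classical all_reals all_analysis.

Set Implicit Arguments.
Unset Strict Implicit.
Unset Printing Implicit Defensive.

Import Order.TTheory GRing.Theory Num.Theory numFieldNormedType.Exports.

Local Open Scope classical_set_scope.
Local Open Scope ring_scope.

(* The library norm on ['rV[R]_k] is the sup norm, hence the following. *)
Definition dot (R : realType) (k : nat) (a b : 'rV[R]_k) : R :=
  \sum_(i < k) a 0 i * b 0 i.

Definition l2norm (R : realType) (k : nat) (a : 'rV[R]_k) : R :=
  Num.sqrt (dot a a).

Definition is_max (R : realType) (A : set R) (M : R) : Prop := A M /\ ubound A M.
Definition is_min (R : realType) (A : set R) (M : R) : Prop := A M /\ lbound A M.

(* [D] is the set on which the function [phi] is considered to be defined. It is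
   kept apart from the strategy sets [X], [Y] of the game: relatively to a compact
   [D], the set of subgradients at a boundary point is invariant under adding
   vectors of the normal cone of [D], hence empty or unbounded. *)
Definition subdifferential (R : realType) (k : nat) (D : set 'rV[R]_k)
    (phi : 'rV[R]_k -> R) (z : 'rV[R]_k) : set 'rV[R]_k :=
  [set s | forall z', D z' -> phi z + dot s (z' - z) <= phi z'].

Definition superdifferential (R : realType) (k : nat) (D : set 'rV[R]_k)
    (phi : 'rV[R]_k -> R) (z : 'rV[R]_k) : set 'rV[R]_k :=
  [set s | forall z', D z' -> phi z' <= phi z + dot s (z' - z)].

Definition concave_function (R : realType) (k : nat) (D : set 'rV[R]_k)
    (phi : 'rV[R]_k -> R) : Prop :=
  convex_function D (fun z => - phi z).

Definition kappa (R : realType) (k : nat) (Z : set 'rV[R]_k) : R :=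
  sup [set l2norm z | z in Z].

Lemma is_max_kappa (R : realType) (k : nat) (Z : set 'rV[R]_k) :
  Z !=set0 -> compact Z -> is_max [set l2norm z | z in Z] (kappa Z).
Proof.
move=> Z0 cZ.
have cn : continuous (@l2norm R k).
  have cd : continuous (fun z : 'rV[R]_k => dot z z).
    apply: continuous_big => [|i _ z]; first exact: add_continuous.
    by apply: (@continuousM _ _ (fun z : 'rV[R]_k => z 0 i)); exact: coord_continuous.
  by move=> z; apply: continuous_comp; [exact: cd | exact: sqrt_continuous].
have [c] := compact_EVT_max Z0 cZ (continuous_subspaceT cn).
rewrite inE => Zc cmax.
have ub : ubound [set l2norm z | z in Z] (l2norm c).
  by move=> _ [z Zz <-]; apply: cmax; rewrite inE.
have -> : kappa Z = l2norm c.
  apply/eqP; rewrite eq_le; apply/andP; split.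
    by apply: ge_sup => //; exists (l2norm c), c.
  by apply: ub_le_sup; [exists (l2norm c) | exists c].
by split=> //; exists c.
Qed.

(* Points of R^(k+1) are row vectors of size [1 + k], whose left block is the
   scalar coordinate. *)
Definition cone (R : realType) (k : nat) (Z : set 'rV[R]_k) :
    set 'rV[R]_(1 + k) :=
  [set a *: row_mx (kappa Z)%:M z | a in [set a | 0 <= a] & z in Z].

(* [xget] selects the point of [C] closest to [u]; it exists and is unique for
   [C] nonempty, closed and convex. *)
Definition proj (R : realType) (k : nat) (C : set 'rV[R]_k) (u : 'rV[R]_k) :
    'rV[R]_k :=
  xget 0 [set w | C w /\ forall w', C w' -> l2norm (u - w) <= l2norm (u - w')].

Definition decision (R : realType) (k : nat) (Z : set 'rV[R]_k)
    (z0 : 'rV[R]_k) (w : 'rV[R]_(1 + k)) : 'rV[R]_k :=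
  if lsubmx w 0 0 == 0 then z0 else (kappa Z / lsubmx w 0 0) *: rsubmx w.

Definition payoff (R : realType) (k : nat) (Z : set 'rV[R]_k)
    (h z : 'rV[R]_k) : 'rV[R]_(1 + k) :=
  row_mx (dot h z / kappa Z)%:M (- h).

(* Sequences are indexed from 1: their value at 0 is never used. [h] is the
   sequence of losses and [z] the sequence of decisions. *)
Definition CBA (R : realType) (omega : nat -> R) (k : nat) (Z : set 'rV[R]_k)
    (h z : nat -> 'rV[R]_k) : Prop :=
  exists (z0 : 'rV[R]_k) (u : nat -> 'rV[R]_(1 + k)),
  [/\ Z z0, Z (z 1%N), u 1%N = omega 1%N *: payoff Z (h 1%N) (z 1%N) &
      forall t : nat, (1 <= t)%N ->
        z t.+1 = decision Z z0 (proj (cone Z) (u t)) /\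
        u t.+1 = u t + omega t.+1 *: payoff Z (h t.+1) (z t.+1)].

Definition CBAplus (R : realType) (omega : nat -> R) (k : nat)
    (Z : set 'rV[R]_k) (h z : nat -> 'rV[R]_k) : Prop :=
  exists (z0 : 'rV[R]_k) (u : nat -> 'rV[R]_(1 + k)),
  [/\ Z z0, Z (z 1%N),
      u 1%N = proj (cone Z) (omega 1%N *: payoff Z (h 1%N) (z 1%N)) &
      forall t : nat, (1 <= t)%N ->
        z t.+1 = decision Z z0 (u t) /\
        u t.+1 =
          proj (cone Z) (u t + omega t.+1 *: payoff Z (h t.+1) (z t.+1))].

Definition repeated_game (R : realType)
    (RM : forall k : nat,
      set 'rV[R]_k -> (nat -> 'rV[R]_k) -> (nat -> 'rV[R]_k) -> Prop)
    (n m : nat) (X Dx : set 'rV[R]_n) (Y Dy : set 'rV[R]_m)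
    (F : 'rV[R]_n -> 'rV[R]_m -> R)
    (x : nat -> 'rV[R]_n) (y : nat -> 'rV[R]_m) : Prop :=
  exists (f : nat -> 'rV[R]_n) (g : nat -> 'rV[R]_m),
  [/\ forall t : nat, (1 <= t)%N ->
        subdifferential Dx (fun x' => F x' (y t)) (x t) (f t),
      forall t : nat, (1 <= t)%N ->
        superdifferential Dy (F (x t)) (y t) (g t),
      RM n X f x & RM m Y (fun t => - g t) y].

Definition weighted_average (R : realType) (k : nat) (theta : nat -> R)
    (z : nat -> 'rV[R]_k) (T : nat) : 'rV[R]_k :=
  (\sum_(1 <= t < T.+1) theta t)^-1 *: \sum_(1 <= t < T.+1) theta t *: z t.

Definition duality_gap_le (R : realType) (n m : nat) (X : set 'rV[R]_n)
    (Y : set 'rV[R]_m) (F : 'rV[R]_n -> 'rV[R]_m -> R)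
    (xbar : 'rV[R]_n) (ybar : 'rV[R]_m) (b : R) : Prop :=
  exists M mu : R,
  [/\ is_max [set F xbar y | y in Y] M, is_min [set F x ybar | x in X] mu &
      `|M - mu| <= b].

(* Main.v *)
(* Both algorithms are instances of Blackwell approachability: the decision rule
   makes the payoff v_t orthogonal to the current point w of the cone C, so
   Moreau's decomposition with respect to C and its polar gives
   |w_T|^2 <= sum_t omega_t^2 |v_t|^2 <= 2 L^2 sum_t omega_t^2 for the projected
   aggregates.  The regret against z is the inner product of the aggregate with
   (kappa, z), a vector of C of norm at most sqrt 2 kappa, hence it is at most
   2 kappa L (sum_t omega_t^2)^(1/2).  For CBA+ a summation by parts shows that
   passing from the weights omega_t to theta_t = t^(q-p) omega_t multiplies this
   bound by at most T^(q-p).  The duality gap is at most the sum of the two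
   regrets divided by S_T, which is bounded by means of S_T >= T^q,
   (q+1) S_T >= T^(q+1) and (p+1) sum_t t^(2p) <= T^(2p+1) + (p+1) T^(2p). *)
Require Import Defs.
From HB Require Import structures.
From mathcomp Require Import all_boot all_order all_algebra.
From mathcomp Require Import all_classical all_reals all_analysis.
From mathcomp Require Import ring lra.

Set Implicit Arguments.
Unset Strict Implicit.
Unset Printing Implicit Defensive.

Import Order.TTheory GRing.Theory Num.Theory numFieldNormedType.Exports.

Local Open Scope classical_set_scope.
Local Open Scope ring_scope.

(** * Euclidean inner product and norm *)

Lemma dotC (R : realType) k (a b : 'rV[R]_k) : dot a b = dot b a.
Proof. by apply: eq_bigr => i _; rewrite mulrC. Qed.

Lemma dotDl (R : realType) k (a b c : 'rV[R]_k) :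
  dot (a + b) c = dot a c + dot b c.
Proof. by rewrite -big_split; apply: eq_bigr => i _; rewrite mxE mulrDl. Qed.

Lemma dotZl (R : realType) k s (a b : 'rV[R]_k) : dot (s *: a) b = s * dot a b.
Proof. by rewrite mulr_sumr; apply: eq_bigr => i _; rewrite mxE mulrA. Qed.

Lemma dotNl (R : realType) k (a b : 'rV[R]_k) : dot (- a) b = - dot a b.
Proof. by rewrite -scaleN1r dotZl mulN1r. Qed.

Lemma dot0l (R : realType) k (b : 'rV[R]_k) : dot 0 b = 0.
Proof. by rewrite -(scale0r b) dotZl mul0r. Qed.

Lemma dotDr (R : realType) k (a b c : 'rV[R]_k) :
  dot a (b + c) = dot a b + dot a c.
Proof. by rewrite !(dotC a) dotDl. Qed.

Lemma dotZr (R : realType) k s (a b : 'rV[R]_k) : dot a (s *: b) = s * dot a b.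
Proof. by rewrite !(dotC a) dotZl. Qed.

Lemma dotNr (R : realType) k (a b : 'rV[R]_k) : dot a (- b) = - dot a b.
Proof. by rewrite !(dotC a) dotNl. Qed.

Lemma dot0r (R : realType) k (a : 'rV[R]_k) : dot a 0 = 0.
Proof. by rewrite dotC dot0l. Qed.

Definition dotE := (dotDl, dotDr, dotNl, dotNr, dotZl, dotZr).

Lemma dot_sumr (R : realType) k (a : 'rV[R]_k) (b : nat -> 'rV[R]_k) m n :
  dot a (\sum_(m <= t < n) b t) = \sum_(m <= t < n) dot a (b t).
Proof. by apply: (big_morph (dot a)); [exact: dotDr | exact: dot0r]. Qed.

Lemma dot_row_mx (R : realType) k (a b : R) (y z : 'rV[R]_k) :
  dot (row_mx a%:M y) (row_mx b%:M z) = a * b + dot y z.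
Proof.
rewrite /dot big_split_ord big_ord1 /= !row_mxEl !mxE !mulr1n; congr (_ + _).
by apply: eq_bigr => i _; rewrite !row_mxEr.
Qed.

Lemma dot_ge0 (R : realType) k (a : 'rV[R]_k) : 0 <= dot a a.
Proof. by apply: sumr_ge0 => i _; rewrite -expr2 sqr_ge0. Qed.

Lemma dot_eq0 (R : realType) k (a : 'rV[R]_k) : (dot a a == 0) = (a == 0).
Proof.
apply/idP/eqP => [|->]; last by rewrite dot0l.
rewrite psumr_eq0 => [/allP a0|i _]; last by rewrite -expr2 sqr_ge0.
apply/rowP => i; rewrite mxE; apply/eqP.
by have := a0 i (mem_index_enum i); rewrite mulf_eq0 orbb.
Qed.

Lemma l2norm_ge0 (R : realType) k (a : 'rV[R]_k) : 0 <= l2norm a.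
Proof. exact: sqrtr_ge0. Qed.

Lemma l2norm_sqr (R : realType) k (a : 'rV[R]_k) : l2norm a ^+ 2 = dot a a.
Proof. by rewrite sqr_sqrtr ?dot_ge0. Qed.

Lemma l2normN (R : realType) k (a : 'rV[R]_k) : l2norm (- a) = l2norm a.
Proof. by rewrite /l2norm !dotE opprK. Qed.

Lemma l2norm_le (R : realType) k j (a : 'rV[R]_k) (b : 'rV[R]_j) :
  (l2norm a <= l2norm b) = (dot a a <= dot b b).
Proof. by rewrite ler_sqrt ?dot_ge0. Qed.

(** Cauchy-Schwarz: for nonzero [a] and [b], expand the squared norm of $|b| a - |a| b$ and divide
    by $|a| |b|$. *)
Lemma dot_le (R : realType) k (a b : 'rV[R]_k) : dot a b <= l2norm a * l2norm b.
Proof.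
have [->|a0] := eqVneq a 0; first by rewrite dot0l mulr_ge0 ?l2norm_ge0.
have [->|b0] := eqVneq b 0; first by rewrite dot0r mulr_ge0 ?l2norm_ge0.
have na : 0 < l2norm a by rewrite sqrtr_gt0 lt_def dot_eq0 a0 dot_ge0.
have nb : 0 < l2norm b by rewrite sqrtr_gt0 lt_def dot_eq0 b0 dot_ge0.
have := dot_ge0 (l2norm b *: a - l2norm a *: b).
rewrite !dotE (dotC b a) -!l2norm_sqr => H.
have := mulr_gt0 na nb => ab.
rewrite -(ler_pM2l ab); lra.
Qed.

Lemma continuous_dot (R : realType) k (T : topologicalType)
    (f g : T -> 'rV[R]_k) :
  continuous f -> continuous g -> continuous (fun t => dot (f t) (g t)).
Proof.
move=> cf cg; apply: continuous_big => [|i _ t]; first exact: add_continuous.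
apply: (@continuousM _ _ (fun t => f t 0 i) (fun t => g t 0 i)).
  apply: (@continuous_comp _ _ _ f (fun z : 'rV[R]_k => z 0 i)); first exact: cf.
  exact: coord_continuous.
apply: (@continuous_comp _ _ _ g (fun z : 'rV[R]_k => z 0 i)); first exact: cg.
exact: coord_continuous.
Qed.

Lemma continuous_l2norm (R : realType) k : continuous (@l2norm R k).
Proof.
move=> z; apply: (@continuous_comp _ _ _ (fun z => dot z z) Num.sqrt).
  by apply: (@continuous_dot _ _ _ id id) => t; exact: cvg_id.
exact: sqrt_continuous.
Qed.

(** * Convex combinations and weighted averages *)

(** Unnormalised weights suit both sums in the cone and running averages. *)
Lemma convex_pair (R : realType) k (Z : set 'rV[R]_k) (a b : R) y z :
  convex_set Z -> 0 <= a -> 0 <= b -> 0 < a + b -> Z y -> Z z ->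
  Z ((a + b)^-1 *: (a *: y + b *: z)).
Proof.
move=> cZ a0 b0 ab Zy Zz.
have l0 : 0 <= a / (a + b) by rewrite divr_ge0 // ltW.
have l1 : a / (a + b) <= 1 by rewrite ler_pdivrMr // mul1r lerDl.
have := cZ y z (Itv01 l0 l1).
rewrite !inE => /(_ Zy Zz) H.
suff -> : (a + b)^-1 *: (a *: y + b *: z) =
    conv (Itv01 l0 l1) (y : convex_lmodType _) z by [].
rewrite /conv /= scalerDr !scalerA mulrC; congr (_ + _ *: _).
by rewrite /unstable.onem; field; apply: lt0r_neq0.
Qed.

Lemma partial_sum_gt0 (R : realType) (theta : nat -> R) T :
  (forall t, (1 <= t)%N -> 0 < theta t) -> (1 <= T)%N ->
  0 < \sum_(1 <= t < T.+1) theta t.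
Proof.
move=> th0; case: T => // T _; rewrite big_nat_recr //= ltr_wpDl ?th0 //.
by rewrite big_nat_cond sumr_ge0 // => t /andP[/andP[t1 _] _]; rewrite ltW ?th0.
Qed.

(** By induction: adding one term forms a convex combination of the previous average and the new
    point. *)
Lemma weighted_average_in (R : realType) k (Z : set 'rV[R]_k) theta z T :
  convex_set Z -> (forall t, (1 <= t)%N -> 0 < theta t) ->
  (forall t, (1 <= t)%N -> Z (z t)) -> (1 <= T)%N ->
  Z (weighted_average theta z T).
Proof.
move=> cZ th0 Zz.
have S0 n := partial_sum_gt0 (T := n) th0.
case: T => // T _; elim: T => [|T IH].
  rewrite /weighted_average !big_nat1 scalerA mulVf ?scale1r; first exact: Zz.
  by rewrite gt_eqF ?th0.
rewrite /weighted_average !(big_nat_recr T.+2) //=.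
have -> : \sum_(1 <= t < T.+2) theta t *: z t =
    (\sum_(1 <= t < T.+2) theta t) *: weighted_average theta z T.+1.
  by rewrite scalerA divff ?scale1r ?gt_eqF ?S0.
apply: convex_pair => //; [exact: ltW (S0 _ _)|exact: ltW (th0 _ _)| |exact: Zz].
by rewrite addr_gt0 ?S0 ?th0.
Qed.

(** * The cone of a strategy set and the projection onto it *)

Lemma kappa_ub {R : realType} {k} {Z : set 'rV[R]_k} {z} :
  compact Z -> Z z -> l2norm z <= kappa Z.
Proof.
move=> cZ Zz; have [_] := is_max_kappa (ex_intro _ z Zz) cZ; apply.
by exists z.
Qed.

(** Otherwise every point of [Z] has norm zero. This licenses the later divisions by [kappa Z]. *)
Lemma kappa_gt0 (R : realType) k (Z : set 'rV[R]_k) :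
  Z !=set0 -> compact Z -> Z <> [set 0] -> 0 < kappa Z.
Proof.
move=> [z0 Zz0] cZ Zn0; rewrite ltNge; apply/negP => kle.
have Z0 z : Z z -> z = 0.
  move=> Zz; apply/eqP; rewrite -dot_eq0 -l2norm_sqr sqrf_eq0 eq_le l2norm_ge0.
  by rewrite (le_trans (kappa_ub cZ Zz)).
by apply: Zn0; apply/seteqP; split => [z /Z0 //|z ->]; rewrite -(Z0 _ Zz0).
Qed.

Lemma cone0 (R : realType) k (Z : set 'rV[R]_k) : Z !=set0 -> cone Z 0.
Proof. by move=> [z Zz]; exists 0 => //=; exists z => //; rewrite scale0r. Qed.

Lemma coneZ (R : realType) k (Z : set 'rV[R]_k) (a : R) w :
  0 <= a -> cone Z w -> cone Z (a *: w).
Proof.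
move=> a0 [b b0 [z Zz <-]]; exists (a * b); first exact: mulr_ge0.
by exists z => //; rewrite scalerA.
Qed.

Lemma coneD (R : realType) k (Z : set 'rV[R]_k) w w' :
  convex_set Z -> cone Z w -> cone Z w' -> cone Z (w + w').
Proof.
move=> cZ [a /= a0 [z Zz <-]] [b /= b0 [z' Zz' <-]].
have := addr_ge0 a0 b0; rewrite le_eqVlt => /predU1P[ab|ab].
  have -> : a = 0 by lra.
  have -> : b = 0 by lra.
  by rewrite !scale0r addr0; apply: cone0; exists z.
exists (a + b); first exact: ltW.
exists ((a + b)^-1 *: (a *: z + b *: z')); first exact: convex_pair.
rewrite !scale_row_mx scalerA divff ?gt_eqF // scale1r add_row_mx; congr row_mx.
by rewrite -scalerDl.
Qed.

(* Beyond the radius [2 |u|] every point of the cone is further from [u] than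
   the apex, so that the minimum over a compact part of the cone is global. *)
Lemma proj_min (R : realType) k (Z : set 'rV[R]_k) (u : 'rV[R]_(1 + k)) :
  Z !=set0 -> compact Z -> 0 < kappa Z ->
  cone Z (Defs.proj (cone Z) u) /\
  forall w, cone Z w -> l2norm (u - Defs.proj (cone Z) u) <= l2norm (u - w).
Proof.
move=> [z0 Zz0] cZ k0; apply: (xgetPex 0 (P := [set w | cone Z w /\
  forall w', cone Z w' -> l2norm (u - w) <= l2norm (u - w')])).
(* A cone point with coefficient beyond [K] has norm at least $2|u|$, since its first coordinate
   already does. *)
have [K K0 KE] : exists2 K, 0 <= K & K = 2 * l2norm u / kappa Z.
  by exists (2 * l2norm u / kappa Z) => //; rewrite divr_ge0 ?mulr_ge0 ?l2norm_ge0 ?ltW.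
pose point (s : R * 'rV[R]_k) := s.1 *: row_mx (kappa Z)%:M s.2.
(* The squared distance from [u] to [point s], written as a polynomial so that its continuity in the
   pair is immediate. *)
pose phi (s : R * 'rV[R]_k) :=
  dot u u - 2 * s.1 * (lsubmx u 0 0 * kappa Z + dot (rsubmx u) s.2) +
  s.1 * s.1 * (kappa Z ^+ 2 + dot s.2 s.2).
have phiE s : phi s = dot (u - point s) (u - point s).
  have uE : u = row_mx (lsubmx u 0 0)%:M (rsubmx u).
    by rewrite -mx11_scalar hsubmxK.
  rewrite !dotE (dotC _ u) {3 4}uE !dot_row_mx /phi; ring.
have cphi : continuous phi.
  have cs : continuous (fun s : R * 'rV[R]_k => s.2) by move=> s; exact: cvg_snd.
  have cf : continuous (fun s : R * 'rV[R]_k => s.1) by move=> s; exact: cvg_fst.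
  have c1 := @continuous_dot _ _ _ (fun=> rsubmx u) _ (fun=> cvg_cst _) cs.
  have c2 := continuous_dot cs cs.
  move=> s; apply: cvgD; first apply: cvgB; first exact: cvg_cst.
    apply: cvgM; first by apply: cvgM; [exact: cvg_cst|exact: cf].
    by apply: cvgD; [exact: cvg_cst|exact: c1].
  apply: cvgM; first by apply: cvgM; exact: cf.
  by apply: cvgD; [exact: cvg_cst|exact: c2].
have B0 : (`[0, K] `*` Z) (0, z0) by split => //=; rewrite in_itv /= lexx.
have [[a z]] := compact_EVT_min (ex_intro _ _ B0)
  (compact_setX (@segment_compact _ 0 K) cZ) (continuous_subspaceT cphi).
rewrite inE => -[/= /itvP aK Zz] mn.
exists (a *: row_mx (kappa Z)%:M z); split.
  by exists a; rewrite /= ?aK //; exists z.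
move=> w' [b /= b0 [z' Zz' <-]].
have [bK|Kb] := leP b K.
  rewrite l2norm_le -(phiE (a, z)) -(phiE (b, z')) mn // inE.
  by split => //=; rewrite in_itv /= b0.
rewrite l2norm_le -(phiE (a, z)) (le_trans (mn (0, z0) _)) ?inE//.
rewrite /phi /= !(mul0r, mulr0, expr0n) /= subr0 addr0 !dotE.
set c := row_mx _ _.
have cc : kappa Z ^+ 2 <= dot c c by rewrite dot_row_mx -expr2 lerDl dot_ge0.
have uc := dot_le u c; rewrite (dotC c u).
have nc : kappa Z <= l2norm c.
  by rewrite -ler_sqr ?nnegrE ?(ltW k0) ?l2norm_ge0 // l2norm_sqr.
have bn : 2 * l2norm u <= b * l2norm c.
  rewrite (@le_trans _ _ (b * kappa Z)) ?ler_wpM2l //.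
  by rewrite -ler_pdivrMr // -KE ltW.
(* By Cauchy-Schwarz and [bn]; this says exactly that $b c$ is no closer to [u] than the apex, when
   $b \ge 0$. *)
have : 2 * dot u c <= b * dot c c.
  rewrite -l2norm_sqr; have := l2norm_ge0 c; nra.
by nra.
Qed.

Lemma proj_cone (R : realType) k (Z : set 'rV[R]_k) (u : 'rV[R]_(1 + k)) :
  Z !=set0 -> compact Z -> 0 < kappa Z -> cone Z (Defs.proj (cone Z) u).
Proof. by move=> Z0 cZ k0; have [] := proj_min u Z0 cZ k0. Qed.

(* The residual [u - proj u] lies in the polar cone ... *)
Lemma proj_polar (R : realType) k (Z : set 'rV[R]_k) (u : 'rV[R]_(1 + k)) c :
  Z !=set0 -> convex_set Z -> compact Z -> 0 < kappa Z ->
  cone Z c -> dot (u - Defs.proj (cone Z) u) c <= 0.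
Proof.
move=> Z0 vZ cZ k0 Cc; have [Cw mn] := proj_min u Z0 cZ k0.
set w := Defs.proj _ _ in Cw mn *; set r := u - w.
(* Minimality of [w] against the competitor $w + t c$. *)
have H t : 0 <= t -> 2 * t * dot r c <= t ^+ 2 * dot c c.
  move=> t0; have := mn _ (coneD vZ Cw (coneZ t0 Cc)).
  by rewrite l2norm_le opprD addrA -/r; clearbody r; rewrite !dotE (dotC c r); lra.
rewrite leNgt; apply/negP => rc.
have cc0 : 0 < dot c c by have := H 1 ler01; lra.
(* The value of [t] minimising the distance to $w + t c$; it turns [H] into $2s \le s$ with $s >
   0$. *)
have := H (dot r c / dot c c) (divr_ge0 (ltW rc) (ltW cc0)).
have -> : (dot r c / dot c c) ^+ 2 * dot c c = dot r c / dot c c * dot r c.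
  by field; rewrite gt_eqF.
have := mulr_gt0 (divr_gt0 rc cc0) rc; lra.
Qed.

(* ... and is orthogonal to the projection. *)
Lemma proj_orth (R : realType) k (Z : set 'rV[R]_k) (u : 'rV[R]_(1 + k)) :
  Z !=set0 -> convex_set Z -> compact Z -> 0 < kappa Z ->
  dot u (Defs.proj (cone Z) u) = dot (Defs.proj (cone Z) u) (Defs.proj (cone Z) u).
Proof.
move=> Z0 vZ cZ k0; have [Cw mn] := proj_min u Z0 cZ k0.
have dle := proj_polar u Z0 vZ cZ k0 Cw.
set w := Defs.proj _ _ in Cw mn dle *.
have dE : dot (u - w) w = dot u w - dot w w by rewrite !dotE.
set d := dot (u - w) w in dle dE.
(* Minimality of [w] against the competitor $(1 - s) w$, which stays in the cone. *)
have H s : 0 <= s <= 1 -> - (2 * s * d) <= s ^+ 2 * dot w w.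
  move=> /andP[s0 s1]; have := mn _ (coneZ (_ : 0 <= 1 - s) Cw).
  rewrite subr_ge0 s1 => /(_ isT).
  rewrite l2norm_le dE !dotE (dotC w u); nra.
suff : 0 <= d by lra.
rewrite leNgt; apply/negP => d0.
(* The best [s] is $-d / |w|^2$; if it exceeds 1, then $s = 1$ already gives a contradiction. *)
have [dw|wd] := leP (- d) (dot w w); last first.
  by have := H 1; rewrite ler01 lexx => /(_ isT); lra.
have w0 : 0 < dot w w by lra.
have s01 : 0 <= - d / dot w w <= 1.
  by rewrite ler_pdivrMr // mul1r dw andbT divr_ge0 // ltW // oppr_gt0.
have := H _ s01.
have -> : (- d / dot w w) ^+ 2 * dot w w = - d / dot w w * - d.
  by field; rewrite gt_eqF.
have : 0 < - d / dot w w * - d by rewrite mulr_gt0 ?divr_gt0 //; lra.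
lra.
Qed.

(** * Decisions, payoffs and growth of the aggregate *)

(** On $w = a (\kappa, z)$ with $a \ne 0$ the decision recovers [z], and the two blocks of the
    payoff cancel against $(\kappa, z)$. If $a = 0$ then $w = 0$ and orthogonality is trivial. *)
Lemma decision_cone (R : realType) k (Z : set 'rV[R]_k) z0 h w :
  0 < kappa Z -> Z z0 -> cone Z w ->
  Z (decision Z z0 w) /\ dot (payoff Z h (decision Z z0 w)) w = 0.
Proof.
move=> k0 Zz0 [a _ [z Zz <-]].
rewrite /decision scale_row_mx row_mxKl row_mxKr !mxE mulr1n mulf_eq0.
rewrite (gt_eqF k0) orbF; have [->|a0] := eqVneq a 0.
  by rewrite !scale0r row_mx0 dot0r.
have -> : (kappa Z / (a * kappa Z)) *: (a *: z) = z.
  rewrite scalerA (_ : _ * a = 1) ?scale1r //; field.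
  by rewrite a0 gt_eqF.
split => //; rewrite -scale_row_mx dotZr dot_row_mx dotNl divfK ?subrr ?mulr0 //.
by rewrite gt_eqF.
Qed.

(** Makes the regret against [z] linear in the payoff, so that it can be read off the aggregate. *)
Lemma dot_payoff (R : realType) k (Z : set 'rV[R]_k) h y z :
  0 < kappa Z ->
  dot (payoff Z h y) (row_mx (kappa Z)%:M z) = dot h (y - z).
Proof. by move=> k0; rewrite dot_row_mx divfK ?gt_eqF// !dotE. Qed.

(** Each block contributes at most $L^2$: for the scalar one, $|\langle h, z\rangle| \le L \kappa$
    by Cauchy-Schwarz. *)
Lemma payoff_le (R : realType) k (Z : set 'rV[R]_k) h z L :
  compact Z -> 0 < kappa Z -> Z z -> l2norm h <= L ->
  dot (payoff Z h z) (payoff Z h z) <= 2 * L ^+ 2.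
Proof.
move=> cZ k0 Zz hL; rewrite dot_row_mx !dotE opprK.
have nh := l2norm_ge0 h; have nz := l2norm_ge0 z.
have L0 : 0 <= L := le_trans nh hL.
have hh : dot h h <= L ^+ 2 by rewrite -l2norm_sqr lerXn2r ?nnegrE.
have hz : `|dot h z / kappa Z| <= L.
  rewrite normrM normfV (gtr0_norm k0) ler_pdivrMr // ler_norml.
  have := dot_le h z; have := dot_le (- h) z.
  rewrite l2normN dotNl => h1 h2; have := ler_pM nh nz hL (kappa_ub cZ Zz).
  by move=> h3; apply/andP; split; lra.
have : (dot h z / kappa Z) ^+ 2 <= L ^+ 2.
  by rewrite -real_normK ?num_real // lerXn2r ?nnegrE ?normr_ge0.
rewrite expr2; lra.
Qed.

(* The decision rule makes the payoff [v] orthogonal to the current point [w],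
   so that squared norms of the projected aggregates add up. *)
Lemma proj_step (R : realType) k (Z : set 'rV[R]_k) (u w v : 'rV[R]_(1 + k)) :
  Z !=set0 -> convex_set Z -> compact Z -> 0 < kappa Z ->
  (forall c, cone Z c -> dot (u - w) c <= 0) -> dot v w = 0 ->
  dot (Defs.proj (cone Z) (u + v)) (Defs.proj (cone Z) (u + v)) <=
    dot w w + dot v v.
Proof.
move=> Z0 vZ cZ k0 uw vw; rewrite -proj_orth //.
(* The polar condition on $u - w$ serves CBA with [w] the projection of [u], and CBA+ with $w = u$.
   The bound then comes from expanding $|w + v - w'|^2 \ge 0$. *)
have := uw _ (proj_cone (u + v) Z0 cZ k0).
have := proj_orth (u + v) Z0 vZ cZ k0.
set w' := Defs.proj _ _; have := dot_ge0 (w + v - w').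
rewrite !dotE (dotC w' w) (dotC w' v) (dotC w v) vw; lra.
Qed.

(** A step from the apex, for the first iterate: the first decision is arbitrary, but every payoff
    is orthogonal to 0. *)
Lemma proj_norm_le (R : realType) k (Z : set 'rV[R]_k)
    (v : 'rV[R]_(1 + k)) :
  Z !=set0 -> convex_set Z -> compact Z -> 0 < kappa Z ->
  dot (Defs.proj (cone Z) v) (Defs.proj (cone Z) v) <= dot v v.
Proof.
move=> Z0 vZ cZ k0; have := @proj_step _ _ Z 0 0 v Z0 vZ cZ k0.
by rewrite subrr dot0r dot0l !add0r; apply=> // c _; rewrite dot0l.
Qed.

Lemma dot_cone_le (R : realType) k (Z : set 'rV[R]_k) w z (L A : R) :
  compact Z -> 0 < kappa Z -> Z z -> 0 <= L -> 0 <= A ->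
  dot w w <= 2 * L ^+ 2 * A ->
  dot w (row_mx (kappa Z)%:M z) <= 2 * kappa Z * L * Num.sqrt A.
Proof.
move=> cZ k0 Zz L0 A0 ww; apply: le_trans (dot_le _ _) _.
have rhs0 : 0 <= 2 * kappa Z * L * Num.sqrt A.
  by rewrite !mulr_ge0 ?sqrtr_ge0 // ltW.
rewrite -ler_sqr ?nnegrE ?rhs0 ?mulr_ge0 ?l2norm_ge0 //.
rewrite !exprMn (sqr_sqrtr A0) !l2norm_sqr dot_row_mx -expr2.
have zz : dot z z <= kappa Z ^+ 2.
  by rewrite -l2norm_sqr lerXn2r ?nnegrE ?(ltW k0) ?l2norm_ge0 ?kappa_ub.
(* The vector $(\kappa, z)$ has squared norm at most $2 \kappa^2$; together with the factor 2 in the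
   bound on [w] this gives $4 = 2^2$. *)
apply: (@le_trans _ _ (2 * L ^+ 2 * A * (2 * kappa Z ^+ 2))); last by lra.
apply: ler_pM => //; first exact: dot_ge0.
  by rewrite addr_ge0 ?sqr_ge0 ?dot_ge0.
by rewrite mulr_natl mulr2n lerD2l.
Qed.

Lemma weighted_payoff_le (R : realType) k (Z : set 'rV[R]_k) h z (L a : R) :
  compact Z -> 0 < kappa Z -> Z z -> l2norm h <= L ->
  dot (a *: payoff Z h z) (a *: payoff Z h z) <= 2 * L ^+ 2 * a ^+ 2.
Proof.
move=> cZ k0 Zz hL; rewrite !dotE mulrA -expr2 mulrC ler_wpM2r ?sqr_ge0 //.
exact: payoff_le.
Qed.

(** * Regret of CBA *)

Lemma CBA_in (R : realType) omega k (Z : set 'rV[R]_k) h z t :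
  Z !=set0 -> compact Z -> 0 < kappa Z -> CBA omega Z h z ->
  (1 <= t)%N -> Z (z t).
Proof.
move=> Z0 cZ k0 [z0 [u [Zz0 Zz1 u1 ut]]]; case: t => [//|[//|t] _].
have [-> _] := ut t.+1 isT.
by have [] := decision_cone 0 k0 Zz0 (proj_cone (u t.+1) Z0 cZ k0).
Qed.

Lemma CBA_regret (R : realType) omega k (Z : set 'rV[R]_k) h z (L : R) T c :
  Z !=set0 -> convex_set Z -> compact Z -> 0 < kappa Z ->
  CBA omega Z h z -> (forall t, (1 <= t)%N -> l2norm (h t) <= L) ->
  (1 <= T)%N -> Z c ->
  \sum_(1 <= t < T.+1) omega t * dot (h t) (z t - c) <=
    2 * kappa Z * L * Num.sqrt (\sum_(1 <= t < T.+1) omega t ^+ 2).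
Proof.
move=> Z0 vZ cZ k0 cba hL T1 Zc.
have Zz t : (1 <= t)%N -> Z (z t) by exact: CBA_in cba.
have L0 : 0 <= L := le_trans (l2norm_ge0 _) (hL 1%N isT).
have [z0 [u [Zz0 _ u1 ut]]] := cba.
have vL t t1 := weighted_payoff_le (omega t) cZ k0 (Zz t t1) (hL t t1).
(* The aggregate is the weighted sum of the payoffs, so its product with $(\kappa, c)$ is the
   regret. *)
have sumE : \sum_(1 <= t < T.+1) omega t * dot (h t) (z t - c) =
    dot (u T) (row_mx (kappa Z)%:M c).
  case: T T1 => // T _; elim: T => [|T IH].
    by rewrite big_nat1 u1 !dotE dot_payoff // dotDr dotNr.
  rewrite big_nat_recr //= IH; have [_ ->] := ut T.+1 isT.
  by rewrite !dotE dot_payoff // dotDr dotNr.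
have norm : dot (Defs.proj (cone Z) (u T)) (Defs.proj (cone Z) (u T)) <=
    2 * L ^+ 2 * \sum_(1 <= t < T.+1) omega t ^+ 2.
  case: T T1 {sumE} => // T _; elim: T => [|T IH].
    rewrite big_nat1 u1; apply: le_trans (vL 1%N isT).
    exact: proj_norm_le.
  rewrite big_nat_recr //= mulrDr.
  have [zE ->] := ut T.+1 isT; apply: le_trans (lerD IH (vL T.+2 isT)).
  apply: proj_step => // [c'|]; first exact: proj_polar.
  have [_] := decision_cone (h T.+2) k0 Zz0 (proj_cone (u T.+1) Z0 cZ k0).
  by rewrite dotZl zE => ->; rewrite mulr0.
have A0 : 0 <= \sum_(1 <= t < T.+1) omega t ^+ 2.
  by apply: sumr_ge0 => t _; exact: sqr_ge0.
rewrite sumE; apply: le_trans (dot_cone_le cZ k0 Zc L0 A0 norm).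
have cc : cone Z (row_mx (kappa Z)%:M c).
  by exists 1 => //=; exists c => //; rewrite scale1r.
(* The norm bound concerns the projection of [u T]; the residual, being polar, only lowers the
   product with $(\kappa, c)$. *)
by have := proj_polar (u T) Z0 vZ cZ k0 cc; rewrite !dotE subr_le0.
Qed.

(** * Regret of CBA+ with separate averaging weights *)

Lemma CBAplus_cone (R : realType) omega k (Z : set 'rV[R]_k) (h z : nat -> 'rV[R]_k)
    (z0 : 'rV[R]_k) (u : nat -> 'rV[R]_(1 + k)) t :
  Z !=set0 -> compact Z -> 0 < kappa Z ->
  u 1%N = Defs.proj (cone Z) (omega 1%N *: payoff Z (h 1%N) (z 1%N)) ->
  (forall t : nat, (1 <= t)%N -> z t.+1 = decision Z z0 (u t) /\
    u t.+1 = Defs.proj (cone Z) (u t + omega t.+1 *: payoff Z (h t.+1) (z t.+1))) ->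
  (1 <= t)%N -> cone Z (u t).
Proof.
move=> Z0 cZ k0 u1 ut; case: t => [//|[_|t _]]; first by rewrite u1; exact: proj_cone.
by have [_ ->] := ut t.+1 isT; exact: proj_cone.
Qed.

Lemma CBAplus_in (R : realType) omega k (Z : set 'rV[R]_k) h z t :
  Z !=set0 -> compact Z -> 0 < kappa Z -> CBAplus omega Z h z ->
  (1 <= t)%N -> Z (z t).
Proof.
move=> Z0 cZ k0 [z0 [u [Zz0 Zz1 u1 ut]]]; case: t => [//|[//|t] _].
have [-> _] := ut t.+1 isT.
by have [] := decision_cone 0 k0 Zz0 (CBAplus_cone (t := t.+1) Z0 cZ k0 u1 ut isT).
Qed.

(* Summation by parts against the nondecreasing [lambda]: the intermediate
   terms are dropped because any two vectors of the cone have a nonnegative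
   inner product, [kappa ^+ 2] dominating [dot y z] on [Z]. *)
Lemma CBAplus_regret (R : realType) omega lambda k (Z : set 'rV[R]_k) h z
    (L : R) T c :
  Z !=set0 -> convex_set Z -> compact Z -> 0 < kappa Z ->
  CBAplus omega Z h z -> (forall t, (1 <= t)%N -> l2norm (h t) <= L) ->
  (forall t, 0 <= lambda t) -> (forall t, lambda t <= lambda t.+1) ->
  (1 <= T)%N -> Z c ->
  \sum_(1 <= t < T.+1) lambda t * omega t * dot (h t) (z t - c) <=
    lambda T * (2 * kappa Z * L * Num.sqrt (\sum_(1 <= t < T.+1) omega t ^+ 2)).
Proof.
move=> Z0 vZ cZ k0 cba hL l0 lS T1 Zc.
have Zz t : (1 <= t)%N -> Z (z t) by exact: CBAplus_in cba.
have L0 : 0 <= L := le_trans (l2norm_ge0 _) (hL 1%N isT).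
have [z0 [u [Zz0 _ u1 ut]]] := cba.
have Cu t := @CBAplus_cone _ _ _ _ _ _ _ _ t Z0 cZ k0 u1 ut.
have vL t t1 := weighted_payoff_le (omega t) cZ k0 (Zz t t1) (hL t t1).
have cc : cone Z (row_mx (kappa Z)%:M c).
  by exists 1 => //=; exists c => //; rewrite scale1r.
have uc t : (1 <= t)%N -> 0 <= dot (u t) (row_mx (kappa Z)%:M c).
  move=> /Cu[a a0 [y Zy <-]]; rewrite dotZl mulr_ge0 // dot_row_mx.
  have := dot_le (- y) c; have nc := l2norm_ge0 c; have ny := l2norm_ge0 y.
  have := ler_pM ny nc (kappa_ub cZ Zy) (kappa_ub cZ Zc).
  by rewrite l2normN dotNl; lra.
have norm : dot (u T) (u T) <= 2 * L ^+ 2 * \sum_(1 <= t < T.+1) omega t ^+ 2.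
  case: T T1 => // T _; elim: T => [|T IH].
    rewrite big_nat1 u1; apply: le_trans (vL 1%N isT).
    exact: proj_norm_le.
  rewrite big_nat_recr //= mulrDr.
  have [zE ->] := ut T.+1 isT; apply: le_trans (lerD IH (vL T.+2 isT)).
  apply: proj_step => // [c' _|]; first by rewrite subrr dot0l.
  rewrite dotZl zE.
  by have [_ ->] := decision_cone (h T.+2) k0 Zz0 (Cu T.+1 isT); rewrite mulr0.
have A0 : 0 <= \sum_(1 <= t < T.+1) omega t ^+ 2.
  by apply: sumr_ge0 => t _; exact: sqr_ge0.
apply: le_trans (ler_wpM2l (l0 T) (dot_cone_le cZ k0 Zc L0 A0 norm)).
case: T T1 {norm A0} => // T _; elim: T => [|T IH].
  rewrite big_nat1 u1 -mulrA ler_wpM2l // -(dot_payoff _ _ _ k0) -dotZl.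
  by rewrite -subr_le0 -dotNl -dotDl; exact: proj_polar.
rewrite big_nat_recr //=.
have [_ uE] := ut T.+1 isT.
(* By nonnegativity of the product, the multiplier of the old aggregate may be raised to the new
   value of [lambda]. *)
have := ler_wpM2r (uc T.+1 isT) (lS T.+1).
(* Projecting an aggregate can only increase its product with a vector of the cone. *)
have : lambda T.+2 * (dot (u T.+1) (row_mx (kappa Z)%:M c) +
    omega T.+2 * dot (h T.+2) (z T.+2 - c)) <=
    lambda T.+2 * dot (u T.+2) (row_mx (kappa Z)%:M c).
  rewrite ler_wpM2l // -(dot_payoff _ _ _ k0) -dotZl -dotDl [in X in _ <= X]uE.
  by rewrite -subr_le0 -dotNl -dotDl; exact: proj_polar.
lra.
Qed.

(** * Sums of powers *)

(** Together with [exprS_diff_le], the mean value bounds on the unit increment of $x^{r+1}$,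
    obtained by induction on [r]. *)
Lemma exprS_diff_ge (R : realType) (x : R) r :
  0 <= x -> r.+1%:R * x ^+ r <= (x + 1) ^+ r.+1 - x ^+ r.+1.
Proof.
move=> x0; elim: r => [|r IH]; first by rewrite !expr0 !expr1; lra.
have xr := exprn_ge0 r x0.
have := ler_wpM2l (_ : 0 <= x + 1) IH; rewrite addr_ge0 // => /(_ isT).
rewrite -(natr1 r.+1) !(exprS _ r.+1) (exprS x r) => H.
have : 0 <= r.+1%:R * x ^+ r by rewrite mulr_ge0.
move: H; lra.
Qed.

Lemma exprS_diff_le (R : realType) (x : R) r :
  0 <= x -> (x + 1) ^+ r.+1 - x ^+ r.+1 <= r.+1%:R * (x + 1) ^+ r.
Proof.
move=> x0; elim: r => [|r IH]; first by rewrite !expr0 !expr1; lra.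
have := ler_wpM2l (_ : 0 <= x + 1) IH; rewrite addr_ge0 // => /(_ isT).
have : x ^+ r.+1 <= (x + 1) ^+ r.+1.
  by rewrite lerXn2r ?nnegrE ?addr_ge0 // lerDl.
rewrite -(natr1 r.+1) !(exprS _ r.+1) (exprS (x + 1) r); lra.
Qed.

(** Telescopes [exprS_diff_le]; the companion [sum_expn_le] telescopes the lower bound on
    increments, which shifts its right-hand side to $T + 1$. *)
Lemma sum_expn_ge (R : realType) r T :
  T%:R ^+ r.+1 <= r.+1%:R * \sum_(1 <= t < T.+1) (t%:R ^+ r : R).
Proof.
elim: T => [|T IH]; first by rewrite big_geq // mulr0 expr0n.
rewrite big_nat_recr //= mulrDr.
have := @exprS_diff_le R T%:R r (ler0n _ _); rewrite natr1; lra.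
Qed.

Lemma sum_expn_le (R : realType) r T :
  r.+1%:R * \sum_(1 <= t < T.+1) (t%:R ^+ r : R) <= T.+1%:R ^+ r.+1.
Proof.
elim: T => [|T IH]; first by rewrite big_geq // mulr0 expr1n.
rewrite big_nat_recr //= mulrDr.
have := @exprS_diff_ge R T.+1%:R r (ler0n _ _); rewrite natr1; lra.
Qed.

Lemma power_weights_le (R : realType) p q T : (p <= q)%N -> (1 <= T)%N ->
  (\sum_(1 <= t < T.+1) (t%:R ^+ q : R))^-1 *
    (T%:R ^+ (q - p) * Num.sqrt (\sum_(1 <= t < T.+1) (t%:R ^+ p) ^+ 2)) <=
  2 * (q.+1%:R / (Num.sqrt p.+1%:R * Num.sqrt T%:R)).
Proof.
case: T => // T pq _.
set S := \sum_(1 <= t < _) t%:R ^+ q; set A := \sum_(1 <= t < _) _ ^+ 2.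
set N : R := T.+1%:R.
have N0 : 0 < N by rewrite ltr0n.
have SN : N ^+ q <= S.
  by rewrite /S big_nat_recr //= lerDr sumr_ge0 // => t _; rewrite exprn_ge0.
have S0 : 0 < S by apply: lt_le_trans SN; rewrite exprn_gt0.
have SN1 : N ^+ q.+1 <= q.+1%:R * S by exact: sum_expn_ge.
have A0 : 0 <= A by apply: sumr_ge0 => t _; exact: sqr_ge0.
(* The last summand is split off because it dominates when [p] is large against the number of terms;
   the shift in [sum_expn_le] then makes the rest a power of [N] itself. *)
have AN : p.+1%:R * A <= N ^+ (2 * p).+1 + p.+1%:R * N ^+ (2 * p).
  rewrite /A big_nat_recr //= mulrDr -exprM mulnC lerD2r.
  apply: le_trans (sum_expn_le _ (2 * p) T); apply: ler_pM => //.
  - by apply: sumr_ge0 => t _; exact: sqr_ge0.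
  - by rewrite ler_nat ltnS mul2n -addnn leq_addr.
  - by apply: ler_sum => t _; rewrite -exprM mulnC.
have pp : 0 < Num.sqrt (p.+1%:R : R) by rewrite sqrtr_gt0.
have NN : 0 < Num.sqrt N by rewrite sqrtr_gt0.
rewrite ler_pdivrMl // !mulrA ler_pdivlMr ?mulr_gt0 //.
rewrite -ler_sqr ?nnegrE; last 2 first.
- by rewrite !mulr_ge0 ?sqrtr_ge0 ?exprn_ge0 // ltW.
- by rewrite !mulr_ge0 // ltW.
rewrite !exprMn !sqr_sqrtr // ?(ltW N0) //.
have -> : (N ^+ (q - p)) ^+ 2 * A * (p.+1%:R * N) =
    N ^+ (2 * (q - p)).+1 * (p.+1%:R * A).
  rewrite -exprM mulnC exprS; ring.
apply: (@le_trans _ _ (N ^+ (2 * (q - p)).+1 *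
    (N ^+ (2 * p).+1 + p.+1%:R * N ^+ (2 * p)))).
  by rewrite ler_wpM2l // exprn_ge0 // ltW.
have -> : N ^+ (2 * (q - p)).+1 * (N ^+ (2 * p).+1 + p.+1%:R * N ^+ (2 * p)) =
    N ^+ q.+1 * N ^+ q.+1 + p.+1%:R * (N ^+ q * N ^+ q.+1).
  have [d ->] : exists d, q = (p + d)%N by exists (q - p)%N; rewrite subnKC.
  by rewrite addKn !exprS !mul2n -!addnn !exprD; ring.
have Nq : 0 <= N ^+ q by rewrite exprn_ge0 // ltW.
have Nq1 : 0 <= N ^+ q.+1 by rewrite exprn_ge0 // ltW.
(* After squaring, each of the two terms is at most $((q+1) S)^2$, the second one using $p \le q$;
   the target allows four times this. *)
have h1 := ler_pM Nq1 Nq1 SN1 SN1.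
have h2 := ler_pM Nq Nq1 SN SN1.
have h3 : p.+1%:R * (N ^+ q * N ^+ q.+1) <= q.+1%:R * (S * (q.+1%:R * S)).
  by apply: ler_pM => //; [rewrite mulr_ge0|rewrite ler_nat].
have : 0 <= (q.+1%:R * S) ^+ 2 by exact: sqr_ge0.
rewrite !expr2; lra.
Qed.

(** * From regret to the duality gap *)

(** A one-sided bound suffices, as it holds for both orders of the points. It serves to show that
    the extrema in the duality gap are attained. *)
Lemma lipschitz_continuous_within (R : realType) k (Z : set 'rV[R]_k)
    (phi : 'rV[R]_k -> R) (L : R) :
  (forall y z, Z y -> Z z -> phi z - phi y <= L * l2norm (z - y)) ->
  {within Z, continuous phi}.
Proof.
move=> lip; apply/subspace_continuousP => y Zy.
apply/cvgrPdist_le => e e0; rewrite near_withinE.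
have c0 : (L * l2norm (z - y)) @[z --> (y : 'rV[R]_k)] --> L * l2norm (y - y).
  have cl : {for y, continuous (fun z : 'rV[R]_k => l2norm (z - y))}.
    apply: (@continuous_comp _ _ _ (fun z : 'rV[R]_k => z - y) (@l2norm R k)).
      apply: (@cvgB R 'rV[R]_k _ (nbhs y) _ id (fun=> y)); first exact: cvg_id.
      exact: cvg_cst.
    exact: continuous_l2norm.
  apply: (@continuousM R _ (fun=> L) (fun z : 'rV[R]_k => l2norm (z - y)) y _ cl).
  exact: cst_continuous.
have l0 : L * l2norm (y - y) = 0.
  by rewrite subrr /l2norm dot0l sqrtr0 mulr0.
rewrite l0 in c0.
near=> z => Zz.
have : `|0 - L * l2norm (z - y)| <= e by near: z; exact: cvgr_dist_le c0 _ e0.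
rewrite sub0r normrN ler_norml => /andP[_ le].
have sym : l2norm (y - z) = l2norm (z - y).
  by rewrite -l2normN opprB.
have := lip _ _ Zy Zz; have := lip _ _ Zz Zy; rewrite sym => h1 h2.
suff : `|phi y - phi z| <= e by [].
by rewrite ler_norml; apply/andP; split; lra.
Unshelve. all: by end_near.
Qed.

(** Jensen's inequality from one affine minorant: the subgradient at the average, whose linear part
    has weighted sum zero. *)
Lemma weighted_jensen (R : realType) k (D : set 'rV[R]_k) phi theta z T s :
  subdifferential D phi (weighted_average theta z T) s ->
  (forall t, (1 <= t)%N -> D (z t)) -> (forall t, (1 <= t)%N -> 0 < theta t) ->
  (1 <= T)%N ->
  (\sum_(1 <= t < T.+1) theta t) * phi (weighted_average theta z T) <=
    \sum_(1 <= t < T.+1) theta t * phi (z t).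
Proof.
move=> sub Dz th0 T1.
have S0 := partial_sum_gt0 th0 T1.
set a := weighted_average _ _ _ in sub *.
have dot0 : \sum_(1 <= t < T.+1) theta t * dot s (z t - a) = 0.
  under eq_bigr => t _ do rewrite dotDr mulrDr -dotZr dotNr.
  rewrite big_split /= -mulr_suml -dot_sumr.
  rewrite /a /weighted_average dotZr; field; exact: lt0r_neq0.
rewrite -[leLHS]addr0 -[X in _ + X <= _]dot0 mulr_suml -big_split /=.
rewrite big_nat_cond [leRHS]big_nat_cond; apply: ler_sum => t /andP[/andP[t1 _] _].
by rewrite -mulrDr ler_wpM2l ?(ltW (th0 _ t1)) //; exact: sub (Dz _ t1).
Qed.

Lemma duality_gap_of_regret (R : realType) n m (X Dx : set 'rV[R]_n)
    (Y Dy : set 'rV[R]_m) (F : 'rV[R]_n -> 'rV[R]_m -> R) (Lx Ly : R)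
    theta x y f g T bx b_y b :
  X !=set0 -> convex_set X -> compact X ->
  Y !=set0 -> convex_set Y -> compact Y ->
  X `<=` Dx -> Y `<=` Dy ->
  (forall x y, X x -> Y y ->
     subdifferential Dx (fun x' => F x' y) x !=set0 /\
     superdifferential Dy (F x) y !=set0) ->
  (forall x y, X x -> Y y ->
     (forall f, subdifferential Dx (fun x' => F x' y) x f -> l2norm f <= Lx) /\
     (forall g, superdifferential Dy (F x) y g -> l2norm g <= Ly)) ->
  (forall t, (1 <= t)%N -> 0 < theta t) ->
  (forall t, (1 <= t)%N -> X (x t)) -> (forall t, (1 <= t)%N -> Y (y t)) ->
  (forall t, (1 <= t)%N -> subdifferential Dx (fun x' => F x' (y t)) (x t) (f t)) ->
  (forall t, (1 <= t)%N -> superdifferential Dy (F (x t)) (y t) (g t)) ->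
  (1 <= T)%N ->
  (forall c, X c -> \sum_(1 <= t < T.+1) theta t * dot (f t) (x t - c) <= bx) ->
  (forall c, Y c -> \sum_(1 <= t < T.+1) theta t * dot (- g t) (y t - c) <= b_y) ->
  (\sum_(1 <= t < T.+1) theta t)^-1 * (bx + b_y) <= b ->
  duality_gap_le X Y F (weighted_average theta x T) (weighted_average theta y T) b.
Proof.
move=> X0 vX cX Y0 vY cY XD YD sub lip th0 Xx Yy fP gP T1 xreg yreg le_b.
set xb := weighted_average theta x T; set yb := weighted_average theta y T.
have Xb : X xb by exact: weighted_average_in.
have Yb : Y yb by exact: weighted_average_in.
(* A supergradient at the starting point bounds the increase of a concave function; for the convex
   one below, a subgradient at the end point does. *)
have cy : {within Y, continuous (F xb)}.
  apply: (@lipschitz_continuous_within _ _ _ _ Ly) => z z' Yz Yz'.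
  have [_ [s sP]] := sub _ _ Xb Yz; have [_ /(_ _ sP) sL] := lip _ _ Xb Yz.
  have := sP _ (YD _ Yz'); have := dot_le s (z' - z).
  have := ler_wpM2r (l2norm_ge0 (z' - z)) sL; lra.
have cx : {within X, continuous (fun x' => F x' yb)}.
  apply: (@lipschitz_continuous_within _ _ _ _ Lx) => z z' Xz Xz'.
  have [[s sP] _] := sub _ _ Xz' Yb; have [/(_ _ sP) sL _] := lip _ _ Xz' Yb.
  have := sP _ (XD _ Xz); have := dot_le (- s) (z - z').
  have -> : l2norm (- s) * l2norm (z - z') = l2norm s * l2norm (z' - z).
    by rewrite l2normN -(l2normN (z - z')) opprB.
  have := ler_wpM2r (l2norm_ge0 (z' - z)) sL; rewrite dotNl; lra.
have [ys] := compact_EVT_max Y0 cY cy; rewrite inE => Yys ysP.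
have [xs] := compact_EVT_min X0 cX cx; rewrite inE => Xxs xsP.
exists (F xb ys), (F xs yb); split.
- by split; [exists ys | move=> _ [z Yz <-]; apply: ysP; rewrite inE].
- by split; [exists xs | move=> _ [z Xz <-]; apply: xsP; rewrite inE].
have ge0 : F xs yb <= F xb ys.
  by apply: le_trans (xsP xb _) (ysP yb _); rewrite inE.
rewrite ger0_norm ?subr_ge0 //; apply: le_trans le_b.
have S0 := partial_sum_gt0 th0 T1.
set S := \sum_(1 <= t < T.+1) theta t in S0 *.
rewrite ler_pdivlMl // mulrBr.
have [[s sP] _] := sub _ _ Xb Yys.
have h1 := weighted_jensen sP (fun t t1 => XD _ (Xx t t1)) th0 T1.
have [_ [s' s'P]] := sub _ _ Xxs Yb.
have s'N : subdifferential Dy (fun z => - F xs z) yb (- s').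
  by move=> z Dz; have := s'P z Dz; rewrite dotNl; lra.
have h2 := weighted_jensen s'N (fun t t1 => YD _ (Yy t t1)) th0 T1.
(* Termwise, insert $F(x_t, y_t)$ and apply the observed subgradient and supergradient at the
   optimal comparators. *)
have h3 : \sum_(1 <= t < T.+1) theta t * F (x t) ys +
    \sum_(1 <= t < T.+1) theta t * - F xs (y t) <=
    \sum_(1 <= t < T.+1) theta t * dot (f t) (x t - xs) +
    \sum_(1 <= t < T.+1) theta t * dot (- g t) (y t - ys).
  rewrite -!big_split /= big_nat_cond [leRHS]big_nat_cond; apply: ler_sum.
  move=> t /andP[/andP[t1 _] _]; rewrite -!mulrDr ler_wpM2l ?(ltW (th0 _ t1)) //.
  have := fP t t1 xs (XD _ Xxs); have := gP t t1 ys (YD _ Yys).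
  rewrite !dotE; lra.
have := xreg _ Xxs; have := yreg _ Yys; move: h1 h2 h3; rewrite -/xb -/yb -/S.
lra.
Qed.

(** The constant 8 combines the 2 of each regret bound, the two players and the 2 of
    [power_weights_le]. *)
Lemma gap_bound (R : realType) p q T (kx ky kap L : R) :
  (p <= q)%N -> (1 <= T)%N -> 0 <= L -> 0 <= kx -> kx <= kap -> ky <= kap ->
  (\sum_(1 <= t < T.+1) (t%:R ^+ q : R))^-1 *
    (T%:R ^+ (q - p) * (2 * kx * L *
      Num.sqrt (\sum_(1 <= t < T.+1) (t%:R ^+ p) ^+ 2)) +
     T%:R ^+ (q - p) * (2 * ky * L *
      Num.sqrt (\sum_(1 <= t < T.+1) (t%:R ^+ p) ^+ 2))) <=
  8 * (kap * L * q.+1%:R / (Num.sqrt p.+1%:R * Num.sqrt T%:R)).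
Proof.
move=> pq T1 L0 kx0 kx_le ky_le.
have W := power_weights_le R pq T1.
set A := \sum_(1 <= t < T.+1) _ ^+ 2 in W *.
set S := \sum_(1 <= t < T.+1) _ in W *; set l := T%:R ^+ (q - p) in W *.
set D := Num.sqrt p.+1%:R * _ in W *.
have S0 : 0 <= S by apply: sumr_ge0 => t _; exact: exprn_ge0.
have l0 : 0 <= l by exact: exprn_ge0.
have W0 : 0 <= S^-1 * (l * Num.sqrt A).
  by rewrite !mulr_ge0 ?invr_ge0 ?sqrtr_ge0.
have kxy : (kx + ky) * L <= 2 * kap * L by rewrite ler_wpM2r //; lra.
have W1 : 0 <= q.+1%:R / D by rewrite divr_ge0 ?mulr_ge0 ?sqrtr_ge0.
have -> : S^-1 * (l * (2 * kx * L * Num.sqrt A) + l * (2 * ky * L * Num.sqrt A))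
    = S^-1 * (l * Num.sqrt A) * (2 * ((kx + ky) * L)) by ring.
have kL : 0 <= kap * L by rewrite mulr_ge0 // (le_trans kx0).
apply: (@le_trans _ _ (S^-1 * (l * Num.sqrt A) * (4 * (kap * L)))).
  by rewrite ler_wpM2l //; lra.
have := ler_wpM2r (_ : 0 <= 4 * (kap * L)) W; rewrite mulr_ge0 // => /(_ isT).
by rewrite -!mulrA; lra.
Qed.

(* F is a convex-concave function on Dx x Dy, and its subgradients are those of
   F as a function on Dx x Dy.  Dx = X, Dy = Y is the case where F is defined
   on X x Y only; Dx = setT, Dy = setT the case where it is defined on the whole
   space. *)
Theorem theorem3p4 (R : realType) :
  exists C : R, 0 < C /\
  forall (n m : nat) (X Dx : set 'rV[R]_n) (Y Dy : set 'rV[R]_m)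
    (F : 'rV[R]_n -> 'rV[R]_m -> R) (Lx Ly : R),
  X !=set0 -> convex_set X -> compact X -> X <> [set 0] ->
  Y !=set0 -> convex_set Y -> compact Y -> Y <> [set 0] ->
  convex_set Dx -> X `<=` Dx ->
  convex_set Dy -> Y `<=` Dy ->
  (forall y, Y y -> convex_function Dx (fun x => F x y)) ->
  (forall x, X x -> concave_function Dy (F x)) ->
  (forall x y, X x -> Y y ->
     subdifferential Dx (fun x' => F x' y) x !=set0 /\
     superdifferential Dy (F x) y !=set0) ->
  (forall x y, X x -> Y y ->
     (forall f, subdifferential Dx (fun x' => F x' y) x f -> l2norm f <= Lx) /\
     (forall g, superdifferential Dy (F x) y g -> l2norm g <= Ly)) ->
  let L := Num.max Lx Ly in
  let kap := sup [set Num.max (l2norm x) (l2norm y) | x in X & y in Y] in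
  (forall (p : nat) (x : nat -> 'rV[R]_n) (y : nat -> 'rV[R]_m),
     let omega := fun t : nat => t%:R ^+ p : R in
     repeated_game (CBA omega) X Dx Y Dy F x y ->
     forall T : nat, (1 <= T)%N ->
       duality_gap_le X Y F
         (weighted_average omega x T) (weighted_average omega y T)
         (C * (kap * L * Num.sqrt p.+1%:R / Num.sqrt T%:R)))
  /\
  (forall (p q : nat) (x : nat -> 'rV[R]_n) (y : nat -> 'rV[R]_m),
     (p <= q)%N ->
     let theta := fun t : nat => t%:R ^+ q : R in
     let omega := fun t : nat => t%:R ^+ p : R in
     repeated_game (CBAplus omega) X Dx Y Dy F x y ->
     forall T : nat, (1 <= T)%N ->
       duality_gap_le X Y F
         (weighted_average theta x T) (weighted_average theta y T)
         (C * (kap * L * q.+1%:R / (Num.sqrt p.+1%:R * Num.sqrt T%:R)))).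
Proof.
exists 8; split=> // n m X Dx Y Dy F Lx Ly X0 vX cX Xn Y0 vY cY Yn _ XD _ YD _ _.
move=> sub lip L kap.
have kX := kappa_gt0 X0 cX Xn; have kY := kappa_gt0 Y0 cY Yn.
(* Nonemptiness and boundedness make [kap] a genuine supremum, so that it dominates both [kappa X]
   and [kappa Y]. *)
have hs : has_sup [set Num.max (l2norm x) (l2norm y) | x in X & y in Y].
  have [x0 Xx0] := X0; have [y0 Yy0] := Y0.
  split; first by exists (Num.max (l2norm x0) (l2norm y0)); exists x0 => //; exists y0.
  exists (Num.max (kappa X) (kappa Y)) => _ [x Xx [y Yy <-]].
  by rewrite ge_max !le_max (kappa_ub cX Xx) (kappa_ub cY Yy) orbT.
have kXk : kappa X <= kap.
  have [[x Xx <-] _] := is_max_kappa X0 cX; have [y Yy] := Y0.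
  apply: (@le_trans _ _ (Num.max (l2norm x) (l2norm y))).
    by rewrite le_max lexx.
  by apply: ub_le_sup; [exact: hs.2|exists x => //; exists y].
have kYk : kappa Y <= kap.
  have [[y Yy <-] _] := is_max_kappa Y0 cY; have [x Xx] := X0.
  apply: (@le_trans _ _ (Num.max (l2norm x) (l2norm y))).
    by rewrite le_max lexx orbT.
  by apply: ub_le_sup; [exact: hs.2|exists x => //; exists y].
have L0 : 0 <= L.
  have [x Xx] := X0; have [y Yy] := Y0.
  have [[f fP] _] := sub _ _ Xx Yy; have [/(_ _ fP) fL _] := lip _ _ Xx Yy.
  by rewrite le_max (le_trans (l2norm_ge0 f) fL).
have fL x y f : X x -> Y y ->
    subdifferential Dx (fun x' => F x' y) x f -> l2norm f <= L.
  by move=> Xx Yy fP; rewrite le_max; have [/(_ _ fP) -> _] := lip _ _ Xx Yy.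
have gL x y g : X x -> Y y -> superdifferential Dy (F x) y g -> l2norm (- g) <= L.
  move=> Xx Yy gP; rewrite le_max; have [_ /(_ _ gP)] := lip _ _ Xx Yy.
  by rewrite l2normN => ->; rewrite orbT.
have pos r t : (1 <= t)%N -> (0 : R) < t%:R ^+ r by move=> t1; rewrite exprn_gt0 ?ltr0n.
split=> [p x y omega [f [g [fP gP cbax cbay]]] T T1
        |p q x y pq theta omega [f [g [fP gP cbax cbay]]] T T1].
- have Xx t : (1 <= t)%N -> X (x t) := CBA_in X0 cX kX cbax.
  have Yy t : (1 <= t)%N -> Y (y t) := CBA_in Y0 cY kY cbay.
  have fL' t (t1 : (1 <= t)%N) := fL _ _ _ (Xx t t1) (Yy t t1) (fP t t1).
  have gL' t (t1 : (1 <= t)%N) := gL _ _ _ (Xx t t1) (Yy t t1) (gP t t1).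
  apply: (duality_gap_of_regret X0 vX cX Y0 vY cY XD YD sub lip (pos p) Xx Yy fP gP T1).
  + by move=> c Xc; exact: CBA_regret X0 vX cX kX cbax fL' T1 Xc.
  + by move=> c Yc; exact: CBA_regret Y0 vY cY kY cbay gL' T1 Yc.
  (* CBA is the case $q = p$, where $T^{q-p} = 1$ and $(p+1)/\sqrt{p+1} = \sqrt{p+1}$. *)
  have := gap_bound (leqnn p) T1 L0 (ltW kX) kXk kYk; rewrite /= subnn expr0 !mul1r.
  move/le_trans; apply; rewrite ler_wpM2l //.
  have -> // : kap * L * p.+1%:R / (Num.sqrt p.+1%:R * Num.sqrt T%:R) =
      kap * L * Num.sqrt p.+1%:R / Num.sqrt T%:R.
  rewrite -[X in _ * X / (_ * _)]sqr_sqrtr //; field.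
  by rewrite !gt_eqF ?sqrtr_gt0 ?ltr0n.
- have Xx t : (1 <= t)%N -> X (x t) := CBAplus_in X0 cX kX cbax.
  have Yy t : (1 <= t)%N -> Y (y t) := CBAplus_in Y0 cY kY cbay.
  have fL' t (t1 : (1 <= t)%N) := fL _ _ _ (Xx t t1) (Yy t t1) (fP t t1).
  have gL' t (t1 : (1 <= t)%N) := gL _ _ _ (Xx t t1) (Yy t t1) (gP t t1).
  (* The nondecreasing multiplier for the summation by parts is $\lambda_t = t^{q-p}$. *)
  have thE t : theta t = t%:R ^+ (q - p) * omega t by rewrite -exprD subnK.
  have l0 t : (0 : R) <= t%:R ^+ (q - p) by rewrite exprn_ge0.
  have lS t : (t%:R : R) ^+ (q - p) <= t.+1%:R ^+ (q - p).
    by rewrite lerXn2r ?nnegrE // ler_nat.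
  apply: (duality_gap_of_regret X0 vX cX Y0 vY cY XD YD sub lip (pos q) Xx Yy fP gP T1).
  + move=> c Xc; under eq_bigr => t _ do rewrite -/(theta t) thE.
    exact: CBAplus_regret X0 vX cX kX cbax fL' l0 lS T1 Xc.
  + move=> c Yc; under eq_bigr => t _ do rewrite -/(theta t) thE.
    exact: CBAplus_regret Y0 vY cY kY cbay gL' l0 lS T1 Yc.
  exact: gap_bound (ltW kX) kXk kYk.
Qed.
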